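(* Let $\lambda>0$ and let $f$ be a finite DC function on $\mathbb{R}^n\times\mathbb{R}^m$. Suppose that $K=\prod_{i=1}^n[-l_i,l_i]\times Y$ with $0\le l_i\le+\infty$ for all $i$ and $Y\subset\mathbb{R}^m$, and that $\kappa>0$ is a constant satisfying $$|f(x,y)-f(x',y)|\le\kappa\|x-x'\|_2\qquad\forall (x,y),(x',y)\in K\text{ with }\|x-x'\|_0\le1.$$ Then for $\theta>\frac{\kappa}{\lambda}$ the problems $$\inf\{f(x,y)+\lambda\|x\|_0:(x,y)\in K\}\quad\text{and}\quad\inf\Big\{f(x,y)+\lambda\sum_{i=1}^n\min\{\theta|x_i|,1\}:(x,y)\in K\Big\}$$ are equivalent, i.e. they have the same set of optimal solutions.
   Context: $\|x\|_0$ is the number of nonzero components of $x\in\mathbb{R}^n$. If $l_i=+\infty$, the interval $[-l_i,l_i]$ means $\mathbb{R}$. A finite DC function is a difference $g-h$ of two finite convex functions. *)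

(* Defs.v *)
From mathcomp Require Import all_boot all_order all_algebra.
From mathcomp Require Import all_classical all_reals all_analysis.

Set Implicit Arguments.
Unset Strict Implicit.
Unset Printing Implicit Defensive.
Import Order.TTheory GRing.Theory Num.Theory.
Local Open Scope classical_set_scope.
Local Open Scope ring_scope.

Definition norm0 (R : realType) (n : nat) (x : 'rV[R]_n) : nat :=
  #|[pred i : 'I_n | x 0 i != 0]|.

(* The library norm of 'rV[R]_n is the sup norm, hence this definition. *)
Definition norm2 (R : realType) (n : nat) (x : 'rV[R]_n) : R :=
  Num.sqrt (\sum_(i < n) x 0 i ^+ 2).

Definition finite_DC (R : realType) (E : lmodType R) (f : E -> R) : Prop :=
  exists g h : E -> R,
    [/\ convex_function [set: E] g, convex_function [set: E] h
      & forall z, f z = g z - h z].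

(* prod_i [-l_i, l_i]; the extended-real bounds give the whole line in the
   i-th coordinate when l i = +oo. *)
Definition sym_box (R : realType) (n : nat) (l : 'I_n -> \bar R) :
    set 'rV[R]_n :=
  [set x | forall i : 'I_n, (- l i <= (x 0%R i)%:E <= l i)%E].

Definition optimal_solutions (R : realType) (T : Type) (K : set T)
    (F : T -> R) : set T :=
  [set z | K z /\ forall z', K z' -> F z <= F z'].

(* Main.v *)
Require Import Defs.
From mathcomp Require Import all_boot all_order all_algebra.
From mathcomp Require Import all_classical all_reals all_analysis.
From mathcomp Require Import lra.

Set Implicit Arguments.
Unset Strict Implicit.
Unset Printing Implicit Defensive.
Import Order.TTheory GRing.Theory Num.Theory.
Local Open Scope classical_set_scope.
Local Open Scope ring_scope.

(* Replacing by 0 one coordinate with 0 < theta |x_i| < 1 keeps the point in the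
   box, lowers the capped penalty by lambda theta |x_i| > kappa |x_i|, and raises
   f by at most kappa |x_i|; so it strictly lowers the capped objective. Hence an
   optimal point of the capped problem has no such coordinate, i.e. both
   objectives agree there, and iterating the replacement from any feasible point
   reaches a feasible point whose l0 objective is at most the initial capped
   one. *)

Definition capped_l1 (R : realType) (n : nat) (theta : R) (x : 'rV[R]_n) : R :=
  \sum_(i < n) Num.min (theta * `|x 0 i|) 1.

Definition zero_coord (R : realType) (n : nat) (i : 'I_n) (x : 'rV[R]_n) :
    'rV[R]_n :=
  \row_j (if j == i then 0 else x 0 j).

Lemma norm0_sum (R : realType) (n : nat) (x : 'rV[R]_n) :
  (norm0 x)%:R = \sum_(i < n) (x 0 i != 0)%:R :> R.
Proof.
rewrite /norm0 -sum1_card natr_sum big_mkcond; apply: eq_bigr => i _.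
by rewrite inE; case: (x 0 i != 0).
Qed.

(** A zero coordinate contributes 0 to both sides, and the cap bounds every other term by 1,
    whatever the sign of [theta]. *)
Lemma capped_l1_le_norm0 (R : realType) (n : nat) (theta : R) (x : 'rV[R]_n) :
  capped_l1 theta x <= (norm0 x)%:R.
Proof.
rewrite norm0_sum; apply: ler_sum => i _; rewrite ge_min.
by have [->|_] := eqVneq (x 0 i) 0; rewrite ?normr0 ?mulr0 lexx ?orbT.
Qed.

Lemma capped_l1_eq_norm0 (R : realType) (n : nat) (theta : R) (x : 'rV[R]_n) :
  (forall i, x 0 i != 0 -> 1 <= theta * `|x 0 i|) ->
  capped_l1 theta x = (norm0 x)%:R.
Proof.
move=> large; rewrite norm0_sum; apply: eq_bigr => i _.
have [->|/large le1] := eqVneq (x 0 i) 0; last exact: min_r.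
by rewrite normr0 mulr0 min_l.
Qed.

Lemma subr_zero_coord (R : realType) (n : nat) (i j : 'I_n) (x : 'rV[R]_n) :
  (zero_coord i x - x) 0 j = if j == i then - x 0 i else 0.
Proof. by rewrite !mxE; case: eqP => [->|_]; rewrite ?sub0r ?subrr. Qed.

Lemma norm0_sub_zero_coord (R : realType) (n : nat) (i : 'I_n) (x : 'rV[R]_n) :
  (norm0 (zero_coord i x - x) <= 1)%N.
Proof.
rewrite -[leqRHS](card1 i); apply/subset_leq_card/fintype.subsetP => j.
by rewrite !inE subr_zero_coord; case: (j == i); rewrite ?eqxx.
Qed.

Lemma norm2_sub_zero_coord (R : realType) (n : nat) (i : 'I_n) (x : 'rV[R]_n) :
  norm2 (zero_coord i x - x) = `|x 0 i|.
Proof.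
rewrite /norm2 (bigD1 i) //= big1 => [|j /negbTE ji].
  by rewrite addr0 subr_zero_coord eqxx sqrrN sqrtr_sqr.
by rewrite subr_zero_coord ji expr0n.
Qed.

(** This strict decrease makes the iterated replacement terminate. *)
Lemma norm0_zero_coord (R : realType) (n : nat) (i : 'I_n) (x : 'rV[R]_n) :
  x 0 i != 0 -> (norm0 (zero_coord i x) < norm0 x)%N.
Proof.
move=> xi; apply/proper_card/properP; split.
  apply/fintype.subsetP => j; rewrite !inE mxE.
  by case: (j == i); rewrite ?eqxx.
by exists i; rewrite !inE // mxE eqxx eqxx.
Qed.

Lemma capped_l1_zero_coord (R : realType) (n : nat) (theta : R) (i : 'I_n)
    (x : 'rV[R]_n) :
  capped_l1 theta x =
  capped_l1 theta (zero_coord i x) + Num.min (theta * `|x 0 i|) 1.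
Proof.
rewrite /capped_l1 (bigD1 i) //= [in RHS](bigD1 i) //= mxE eqxx normr0 mulr0.
rewrite (min_l ler01) add0r addrC; congr (_ + _).
by apply: eq_bigr => j /negbTE ji; rewrite mxE ji.
Qed.

Lemma sym_box_zero_coord (R : realType) (n : nat) (l : 'I_n -> \bar R)
    (i : 'I_n) (x : 'rV[R]_n) :
  (0 <= l i)%E -> sym_box l x -> sym_box l (zero_coord i x).
Proof.
move=> li boxx j; rewrite mxE; case: eqP => [->|_]; last exact: boxx.
by rewrite li andbT leeNl oppe0.
Qed.

(** Here [f] stands for a slice of the objective at a fixed second component, since the replacement
    changes only the first one. *)
Section CappedDescent.
Variables (R : realType) (n : nat) (lambda kappa theta : R).
Variables (l : 'I_n -> \bar R) (f : 'rV[R]_n -> R).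
Hypothesis lambda_gt0 : 0 < lambda.
Hypothesis l_ge0 : forall i, (0 <= l i)%E.
Hypothesis theta_gt : kappa / lambda < theta.
Hypothesis f_lip : forall x x', sym_box l x -> sym_box l x' ->
  (norm0 (x - x') <= 1)%N -> `|f x - f x'| <= kappa * norm2 (x - x').

Lemma capped_zero_coord_lt (i : 'I_n) (x : 'rV[R]_n) :
  sym_box l x -> x 0 i != 0 -> theta * `|x 0 i| < 1 ->
  f (zero_coord i x) + lambda * capped_l1 theta (zero_coord i x) <
  f x + lambda * capped_l1 theta x.
Proof.
move=> boxx xi small.
have := f_lip (sym_box_zero_coord (l_ge0 i) boxx) boxx
  (norm0_sub_zero_coord i x).
rewrite norm2_sub_zero_coord => /(le_trans (ler_norm _)) fle.
(* The bound on [theta] gives [kappa < lambda * theta]; strictness survives the product because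
   [x 0 i] is nonzero. *)
have : kappa * `|x 0 i| < lambda * (theta * `|x 0 i|).
  by rewrite mulrA ltr_pM2r ?normr_gt0 // mulrC -ltr_pdivrMr.
rewrite (capped_l1_zero_coord theta i x) min_l ?(ltW small) // mulrDr.
lra.
Qed.

(** By strong induction on [norm0 x]: either every nonzero coordinate reaches the cap and [x] itself
    is the witness, or zeroing one that does not lowers both the capped objective and [norm0]. *)
Lemma norm0_le_capped (x : 'rV[R]_n) : sym_box l x ->
  exists2 x', sym_box l x' &
    f x' + lambda * (norm0 x')%:R <= f x + lambda * capped_l1 theta x.
Proof.
have [k] := ubnP (norm0 x); elim: k => // k IHk in x * => xk boxx.
have [large|] := pselect (forall i, x 0 i != 0 -> 1 <= theta * `|x 0 i|).
  by exists x => //; rewrite capped_l1_eq_norm0.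
move=> /existsNP[i /not_implyP[xi /negP]]; rewrite -ltNge => small.
have [|x' boxx' le'] := IHk (zero_coord i x) _
  (sym_box_zero_coord (l_ge0 i) boxx).
  exact: leq_trans (norm0_zero_coord xi) xk.
by exists x' => //; apply/(le_trans le')/ltW/capped_zero_coord_lt.
Qed.

End CappedDescent.

Theorem proposition4 (R : realType) (n m : nat) (lambda : R)
    (f : 'rV[R]_n * 'rV[R]_m -> R)
    (l : 'I_n -> \bar R) (Y : set 'rV[R]_m)
    (K : set ('rV[R]_n * 'rV[R]_m)) (kappa theta : R)
    (lambda_gt0 : 0 < lambda)
    (fDC : finite_DC f)
    (l_ge0 : forall i, (0 <= l i)%E)
    (KE : K = sym_box l `*` Y)
    (kappa_gt0 : 0 < kappa)
    (f_lip : forall (x x' : 'rV[R]_n) (y : 'rV[R]_m),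
        K (x, y) -> K (x', y) -> (norm0 (x - x') <= 1)%N ->
        `|f (x, y) - f (x', y)| <= kappa * norm2 (x - x'))
    (theta_gt : kappa / lambda < theta) :
  optimal_solutions K (fun z => f z + lambda * (norm0 z.1)%:R)
  = optimal_solutions K (fun z => f z +
      lambda * \sum_(i < n) Num.min (theta * `|z.1 0 i|) 1).
Proof.
have lip y : Y y -> forall x x', sym_box l x -> sym_box l x' ->
    (norm0 (x - x') <= 1)%N ->
    `|f (x, y) - f (x', y)| <= kappa * norm2 (x - x').
  by move=> Yy x x' bx bx'; apply: f_lip; rewrite KE.
have capped_le x : lambda * capped_l1 theta x <= lambda * (norm0 x)%:R.
  by rewrite ler_pM2l // capped_l1_le_norm0.
apply/seteqP; split=> -[x y] [Kxy opt]; split=> // -[x1 y1] Kxy1.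
- have [bx1 Yy1] : (sym_box l `*` Y) (x1, y1) by rewrite -KE.
  have [x' bx' le'] := norm0_le_capped lambda_gt0 l_ge0 theta_gt (lip _ Yy1) bx1.
  (* Chain: capped at [(x, y)], l0 at [(x, y)], l0 at [(x', y1)], capped at [(x1, y1)]; the middle
     inequality is optimality. *)
  apply: le_trans le'; apply: le_trans (opt (x', y1) _); last by rewrite KE.
  by rewrite lerD2l; exact: capped_le.
- have [bx Yy] : (sym_box l `*` Y) (x, y) by rewrite -KE.
  (* A nonzero coordinate below the cap could be zeroed, giving a feasible point that contradicts
     capped optimality. *)
  have large i : x 0 i != 0 -> 1 <= theta * `|x 0 i|.
    move=> xi; rewrite leNgt; apply/negP => small.
    have := capped_zero_coord_lt lambda_gt0 l_ge0 theta_gt (lip _ Yy) bx xi small.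
    apply/negP; rewrite -leNgt; apply: (opt (zero_coord i x, y)).
    by rewrite KE; split=> //; exact: sym_box_zero_coord.
  (* The two objectives agree at [(x, y)], while at the competitor the capped one is at most the l0
     one. *)
  rewrite /= -(capped_l1_eq_norm0 large); apply: le_trans (opt _ Kxy1) _.
  by rewrite lerD2l; exact: capped_le.
Qed.
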